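(* There exists a Devaney chaotic t.d.s. with positive topological entropy that is almost mean equicontinuous, and hence not mean sensitive.
   Context: A t.d.s. (topological dynamical system) is a pair $(X,T)$ where $X$ is a non-empty compact metric space with metric $d$ and $T\colon X\to X$ is continuous; $\mathbb{N}$ denotes the positive integers. $(X,T)$ is transitive if for all non-empty open $U,V\subset X$ there is $n\in\mathbb{N}$ with $T^nU\cap V\neq\emptyset$. A point $x$ is periodic if $T^nx=x$ for some $n\in\mathbb{N}$. $(X,T)$ is Devaney chaotic if it is transitive and its set of periodic points is dense. A point $x\in X$ is mean equicontinuous if for every $\varepsilon>0$ there is $\delta>0$ such that for every $y\in X$ with $d(x,y)<\delta$ we have $\limsup_{n\to\infty}\frac1n\sum_{i=0}^{n-1}d(T^ix,T^iy)<\varepsilon$. $(X,T)$ is almost mean equicontinuous if the set of mean equicontinuous points is residual (contains a dense $G_\delta$ set). $(X,T)$ is mean sensitive if there is $\delta>0$ such that for every non-empty open $U\subset X$ there are $x,y\in U$ with $\limsup_{n\to\infty}\frac1n\sum_{i=0}^{n-1}d(T^ix,T^iy)>\delta$. *)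

(* Defs.v *)
From HB Require Import structures.
From mathcomp Require Import all_boot all_order all_algebra finmap.
From mathcomp Require Import all_classical all_reals all_analysis borel_hierarchy.

Set Implicit Arguments.
Unset Strict Implicit.
Unset Printing Implicit Defensive.

Import Order.TTheory GRing.Theory Num.Theory.
Import numFieldNormedType.Exports.

Local Open Scope classical_set_scope.
Local Open Scope ring_scope.

Definition tds (R : realType) (X : metricType R) (T : X -> X) : Prop :=
  [/\ [set: X] !=set0, compact [set: X] & continuous T].

Definition topologically_transitive (X : topologicalType) (T : X -> X) : Prop :=
  forall U V : set X, open U -> U !=set0 -> open V -> V !=set0 ->
    exists2 n : nat, (0 < n)%N & (iter n T @` U) `&` V !=set0.

Definition periodic_point (X : Type) (T : X -> X) (x : X) : Prop :=
  exists2 n : nat, (0 < n)%N & iter n T x = x.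

Definition devaney_chaotic (X : topologicalType) (T : X -> X) : Prop :=
  topologically_transitive T /\ dense [set x : X | periodic_point T x].

Definition residual (X : topologicalType) (A : set X) : Prop :=
  exists G : set X, [/\ Gdelta G, dense G & G `<=` A].

(* The upper limit is taken in \bar R, so that it never takes a default value.
   The term n = 0 (where 0^-1 = 0) is irrelevant to it. *)
Definition limsup_mean_dist (R : realType) (X : metricType R) (T : X -> X)
    (x y : X) : \bar R :=
  limn_esup (fun n : nat =>
    (n%:R^-1 * \sum_(i < n) mdist (iter i T x) (iter i T y))%:E).

Definition mean_equicontinuous_point (R : realType) (X : metricType R)
    (T : X -> X) (x : X) : Prop :=
  forall e : R, 0 < e -> exists2 delta : R, 0 < delta &
    forall y : X, mdist x y < delta -> (limsup_mean_dist T x y < e%:E)%E.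

Definition almost_mean_equicontinuous (R : realType) (X : metricType R)
    (T : X -> X) : Prop :=
  residual [set x : X | mean_equicontinuous_point T x].

Definition mean_sensitive (R : realType) (X : metricType R)
    (T : X -> X) : Prop :=
  exists2 delta : R, 0 < delta &
    forall U : set X, open U -> U !=set0 ->
      exists x y : X, [/\ U x, U y & (delta%:E < limsup_mean_dist T x y)%E].

(* Topological entropy, by Bowen's definition with (n, e)-separated sets. *)
Definition bowen_dist (R : realType) (X : metricType R) (T : X -> X)
    (n : nat) (x y : X) : R :=
  \big[Num.max/0]_(i < n) mdist (iter i T x) (iter i T y).

Definition bowen_separated (R : realType) (X : metricType R) (T : X -> X)
    (n : nat) (e : R) (E : {fset X}) : Prop :=
  forall x y : X, x \in E -> y \in E -> x != y -> e < bowen_dist T n x y.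

Definition max_separated (R : realType) (X : metricType R) (T : X -> X)
    (n : nat) (e : R) : \bar R :=
  ereal_sup [set (#|` E|%fset%:R)%:E | E in [set E | bowen_separated T n e E]].

Definition entropy_at_scale (R : realType) (X : metricType R) (T : X -> X)
    (e : R) : \bar R :=
  limn_esup (fun n : nat => ((n%:R^-1)%:E * lne (max_separated T n e))%E).

(* entropy_at_scale T is nonincreasing in e, so the limit always exists. *)
Definition topological_entropy (R : realType) (X : metricType R)
    (T : X -> X) : \bar R :=
  lim (entropy_at_scale T e @[e --> 0^'+]).

(* Main.v *)
Require Import Defs.
From HB Require Import structures.
From mathcomp Require Import all_boot all_order all_algebra finmap zify ring.
From mathcomp Require Import all_classical all_reals all_analysis.
From mathcomp Require Import borel_hierarchy.

Set Implicit Arguments.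
Unset Strict Implicit.
Unset Printing Implicit Defensive.

Import Order.TTheory GRing.Theory Num.Theory.
Import numFieldNormedType.Exports.

(** The system is a one-sided subshift over the symbols 0, 1, 2.  A block 1^k 2
    acts as a marker of strength k: in a point of the subshift, once such a
    block has occurred, every later window that starts right after it has at
    most a fraction 1/(k+1) of non-zero symbols.  This is a condition on finite
    windows, so it cuts out a closed shift-invariant set.

    Sequences without the symbol 2 contain no marker and are unconstrained, so
    the full shift on {0, 1} sits inside the subshift and the entropy is at
    least ln 2 ([topological_entropy_shift_gt0]).

    Markers are cheap to accommodate because zeros never violate the condition.
    A finite prefix has length N, hence only markers of strength < N, so a
    sequence made of prefixes of length N of points of the subshift, separated
    by N^2 zeros, is again in the subshift ([admissible_spaced]): after a prefix
    has ended, each further prefix brings at most N non-zero symbols, preceded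
    by enough zeros to keep the fraction at most 1/N.  Alternating the prefixes
    of two points in this way gives a periodic point near the first one whose
    orbit passes near the second one; both halves of Devaney chaos follow.

    A point that contains markers of every strength is mean equicontinuous: all
    points close to it share its marker of strength k, so that from some time on
    both orbits are, outside a set of times of small upper density, close to
    the fixed point 0 ([limsup_mean_dist_marker]).  Such points
    form a G_delta set, which is dense because markers of strength 0, 1, 2 and
    so on can be appended one after the other to any prefix, with long enough
    gaps ([exists_rich]).  The same estimate, applied to the open set of points
    that start with one strong marker, excludes mean sensitivity. *)

(** * Sequences with markers *)

Definition num_nonzero (x : nat -> nat) (a m : nat) : nat :=
  \sum_(j < m) (x (a + j) != 0).

(** The block 1^k 2 at position i. *)
Definition marker (k : nat) (x : nat -> nat) (i : nat) : Prop :=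
  (forall j, j < k -> x (i + j) = 1) /\ x (i + k) = 2.

Definition admissible (x : nat -> nat) : Prop :=
  (forall n, x n < 3) /\
  (forall k i, marker k x i ->
     forall m, k.+1 * num_nonzero x (i + k).+1 m <= m).

Definition agree (n : nat) (x y : nat -> nat) : Prop :=
  forall i, i < n -> x i = y i.

Lemma agree_sym n x y : agree n x y -> agree n y x.
Proof. by move=> xy i /xy. Qed.

Lemma agree_trans n x y z : agree n x y -> agree n y z -> agree n x z.
Proof. by move=> xy yz i lin; rewrite xy // yz. Qed.

Lemma agree_leq m n x y : m <= n -> agree n x y -> agree m x y.
Proof. by move=> mn xy i im; apply: xy; apply: leq_trans mn. Qed.

Lemma num_nonzero_leq x a m : num_nonzero x a m <= m.
Proof.
rewrite /num_nonzero -[leqRHS]card_ord -sum1_card; apply: leq_sum => j _.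
by case: (_ != 0).
Qed.

Lemma num_nonzeroD x a m n :
  num_nonzero x a (m + n) = num_nonzero x a m + num_nonzero x (a + m) n.
Proof.
rewrite /num_nonzero big_split_ord /=; congr (_ + _).
by apply: eq_bigr => j _; rewrite addnA.
Qed.

Lemma num_nonzero_leqD x a m n : num_nonzero x a m <= num_nonzero x a (m + n).
Proof. by rewrite num_nonzeroD leq_addr. Qed.

Lemma eq_num_nonzero x y a b m : (forall j, j < m -> x (a + j) = y (b + j)) ->
  num_nonzero x a m = num_nonzero y b m.
Proof. by move=> xy; apply: eq_bigr => j _; rewrite xy. Qed.

Lemma num_nonzero_eq0 x a m :
  (forall j, j < m -> x (a + j) = 0) -> num_nonzero x a m = 0.
Proof. by move=> x0; rewrite /num_nonzero big1 // => j _; rewrite x0. Qed.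

Lemma eq_marker x y i j k : (forall l, l <= k -> x (i + l) = y (j + l)) ->
  marker k x i -> marker k y j.
Proof.
move=> xy [x1 x2]; split=> [l lk|]; last by rewrite -xy.
by rewrite -xy ?x1 // ltnW.
Qed.

(** Admissibility only constrains finite windows, whence the admissible
    sequences form a closed set. *)
Lemma admissible_limit z :
  (forall n, exists2 u, admissible u & agree n u z) -> admissible z.
Proof.
move=> uz; split=> [n|k i zi m].
  by have [u [u3 _] <- //] := uz n.+1.
have [u [_ uP] uzE] := uz ((i + k).+1 + m).
rewrite -(@eq_num_nonzero u z (i + k).+1); last by move=> j jm; apply: uzE; lia.
by apply: uP; apply: eq_marker zi => l lk; rewrite uzE //; lia.
Qed.

Lemma admissible_binary x : (forall n, x n < 2) -> admissible x.
Proof.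
move=> x2; split=> [n|k i [_ xk]]; first exact: leq_trans (x2 n) _.
by have := x2 (i + k); rewrite xk.
Qed.

Definition marker_word (k n : nat) : nat :=
  if n < k then 1 else if n == k then 2 else 0.

Lemma marker_marker_word k : marker k (marker_word k) 0.
Proof.
by split=> [j jk|]; rewrite /marker_word add0n ?jk // ltnn eqxx.
Qed.

Lemma admissible_marker_word k : admissible (marker_word k).
Proof.
have w0 n : k < n -> marker_word k n = 0.
  by move=> kn; rewrite /marker_word ltnNge (ltnW kn) (gtn_eqF kn).
split=> [n|l i [_ w2] m].
  by rewrite /marker_word; case: ifP => // _; case: ifP.
rewrite num_nonzero_eq0 ?muln0 // => j _; apply: w0.
move: w2; rewrite /marker_word; case: ifP => //; case: eqP => //; lia.
Qed.

Definition spaced_block_size (N : nat) : nat := N * N + N.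

(** Only the first [N] symbols of each [w q] matter.  The N^2 zeros after them
    outweigh, N to 1, the non-zero symbols of the next word. *)
Definition spaced (N : nat) (w : nat -> nat -> nat) (n : nat) : nat :=
  let B := spaced_block_size N in
  if n %% B < N then w (n %/ B) (n %% B) else 0.

Lemma spaced_word N w q r : r < N ->
  spaced N w (q * spaced_block_size N + r) = w q r.
Proof.
move=> rN; have rB : r < spaced_block_size N by rewrite /spaced_block_size; nia.
rewrite /spaced modnMDl modn_small // rN divnMDl; last by lia.
by rewrite divn_small // addn0.
Qed.

Lemma spaced_gap N w q r : N <= r < spaced_block_size N ->
  spaced N w (q * spaced_block_size N + r) = 0.
Proof.
by case/andP=> Nr rB; rewrite /spaced modnMDl modn_small // ltnNge Nr.
Qed.

(** The windows considered start at the beginning of a gap, so each word met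
    later is paid for by the N^2 zeros before it: its at most N non-zero symbols
    weigh N * N. *)
Lemma spaced_gap_sparse N w q m :
  N * num_nonzero (spaced N w) (q * spaced_block_size N + N) m <= m.
Proof.
set B := spaced_block_size N; set z := spaced N w.
have BE : B = N * N + N by [].
elim/ltn_ind: m q => m IH q; have [->|N0] := posnP N; first by [].
have gap l : l <= N * N -> num_nonzero z (q * B + N) l = 0.
  by move=> lN; apply: num_nonzero_eq0 => j jl;
     rewrite /z -addnA spaced_gap // -/B; lia.
have [mN|Nm] := leqP m (N * N); first by rewrite gap ?muln0.
have -> : m = N * N + (m - N * N) by lia.
rewrite num_nonzeroD gap // add0n.
have [mB|Bm] := leqP m B.
  by have := num_nonzero_leq z (q * B + N + N * N) (m - N * N); nia.
have -> : m - N * N = N + (m - B) by lia.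
rewrite num_nonzeroD; have -> : q * B + N + N * N + N = q.+1 * B + N by lia.
have := IH (m - B) _ q.+1; rewrite -/z.
by have := num_nonzero_leq z (q * B + N + N * N) N; nia.
Qed.

(** A run of non-zero symbols cannot cross a gap, so it lies in one word. *)
Lemma spaced_run N w i k :
  (forall j, j <= k -> spaced N w (i + j) != 0) ->
  i %% spaced_block_size N + k < N.
Proof.
set B := spaced_block_size N; have BE : B = N * N + N by [].
have word n : spaced N w n != 0 -> n %% B < N.
  by rewrite /spaced -/B; case: ifP.
elim: k => [|k IH] z0.
  by rewrite addn0; have := z0 0; rewrite addn0 => /(_ isT)/word.
have /IH ikN : forall j, j <= k -> spaced N w (i + j) != 0.
  by move=> j jk; apply: z0; rewrite (leqW jk).
have := word _ (z0 k.+1 (leqnn _)).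
rewrite -modnDml modn_small //; apply: leq_ltn_trans (_ : N < B); first by lia.
by rewrite BE -addn1 addnC leq_add2r muln_gt0; lia.
Qed.

(** A marker lies inside one word, and so has strength k < N.  Up to the end of
    this word the constraint is inherited from [w q]; beyond it the density is
    at most 1/N <= 1/(k+1) by [spaced_gap_sparse]. *)
Lemma admissible_spaced N w : (forall q, admissible (w q)) ->
  admissible (spaced N w).
Proof.
set B := spaced_block_size N; have BE : B = N * N + N by [].
move=> wP; split=> [n|k i zi m].
  by rewrite /spaced; case: ifP => // _; apply: (wP _).1.
set z := spaced N w in zi *.
have := @spaced_run N w i k; rewrite -/B => /(_ _)/wrap[|rkN].
  move=> j jk.
  rewrite -/z; case: zi => z1 z2.
  move: jk; rewrite leq_eqVlt => /orP[/eqP->|/z1 ->] //.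
  by rewrite z2.
set r := i %% B in rkN; set q := i %/ B.
have iE : i = q * B + r by rewrite /q /r -divn_eq.
have wi : marker k (w q) r.
  apply: eq_marker zi => l lk.
  by rewrite /z iE -addnA spaced_word //; lia.
have zw l : (r + k).+1 + l <= N ->
    num_nonzero z (i + k).+1 l = num_nonzero (w q) (r + k).+1 l.
  move=> lN; apply: eq_num_nonzero => j jl.
  rewrite iE.
  have -> : (q * B + r + k).+1 + j = q * B + ((r + k).+1 + j) by lia.
  by rewrite /z spaced_word //; lia.
have [short|long] := leqP ((r + k).+1 + m) N.
  by rewrite zw //; apply: (wP q).2.
have -> : m = (N - (r + k).+1) + (m - (N - (r + k).+1)) by lia.
rewrite num_nonzeroD mulnDr; apply: leq_add.
  by rewrite zw; [apply: (wP q).2|lia].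
have -> : (i + k).+1 + (N - (r + k).+1) = q * B + N by lia.
by apply: leq_trans (spaced_gap_sparse N w q _); rewrite leq_mul2r; lia.
Qed.

Definition periodic_spaced N (x y : nat -> nat) : nat -> nat :=
  spaced N (fun q => if odd q then y else x).

Lemma periodic_spacedD N x y n :
  periodic_spaced N x y (n + 2 * spaced_block_size N) = periodic_spaced N x y n.
Proof.
set B := spaced_block_size N; rewrite /periodic_spaced /spaced -/B.
rewrite addnC modnMDl; case: ifP => // nN.
by rewrite divnMDl ?oddD //; rewrite /B /spaced_block_size; lia.
Qed.

Lemma periodic_spaced_fst N x y : agree N x (periodic_spaced N x y).
Proof.
move=> i iN; rewrite -[i in RHS]/(0 * spaced_block_size N + i).
by rewrite /periodic_spaced spaced_word.
Qed.

Lemma periodic_spaced_snd N x y :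
  agree N y (fun i => periodic_spaced N x y (spaced_block_size N + i)).
Proof.
move=> i iN; rewrite -[spaced_block_size N]mul1n /periodic_spaced.
by rewrite spaced_word.
Qed.

(** After k steps: a sequence that contains all markers of strength < k, and a
    length within which they occur.  Each step keeps the current prefix and
    appends the next marker; the gaps of [spaced] grow with it. *)
Fixpoint enrich (x : nat -> nat) (N k : nat) : (nat -> nat) * nat :=
  if k is k'.+1 then
    let: (u, n) := enrich x N k' in
    let M := maxn n k'.+1 in
    (spaced M (fun q => if q == 0 then u else marker_word k'),
     2 * spaced_block_size M)
  else (x, N).

Lemma enrichP x N k : let: (u, n) := enrich x N k in
  let: (u', n') := enrich x N k.+1 in
  [/\ admissible u -> admissible u', n < n', agree n u u' &
    exists2 i, i + k < n' & marker k u' i].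
Proof.
rewrite [enrich x N k.+1]/=; case: (enrich x N k) => u n.
set M := maxn n k.+1; set B := spaced_block_size M.
set w := (fun q => _); have BE : B = M * M + M by [].
have nM : n <= M by rewrite leq_maxl.
have kM : k < M by rewrite leq_maxr.
split.
- move=> uP; apply: admissible_spaced => q; rewrite /w.
  by case: ifP => // _; apply: admissible_marker_word.
- by nia.
- move=> i ni; have := @spaced_word M w 0 i; rewrite mul0n add0n => -> //.
  exact: leq_trans nM.
- exists B; first by lia.
  apply: eq_marker (marker_marker_word k) => l lk.
  by have := @spaced_word M w 1 l; rewrite mul1n => -> //; lia.
Qed.

(** The sequences produced by [enrich] extend longer and longer prefixes of one
    another; their limit contains every marker. *)
Lemma exists_rich x N : admissible x -> exists z,
  [/\ admissible z, agree N x z & forall k, exists i, marker k z i].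
Proof.
move=> xP; pose u k := (enrich x N k).1; pose n k := (enrich x N k).2.
have step k : [/\ admissible (u k) -> admissible (u k.+1), n k < n k.+1,
    agree (n k) (u k) (u k.+1) &
    exists2 i, i + k < n k.+1 & marker k (u k.+1) i].
  have := enrichP x N k; rewrite /u /n.
  by case: (enrich x N k) => ? ?; case: (enrich x N k.+1).
have uP k : admissible (u k) by elim: k => // k; have [] := step k.
have n_mono k l : n k <= n (k + l).
  elim: l => [|l IH]; first by rewrite addn0.
  by have [_ + _ _] := step (k + l); rewrite addnS; lia.
have n_ge k : k <= n k.
  by elim: k => // k; have [_ + _ _] := step k; lia.
have u_agree k l : agree (n k) (u k) (u (k + l)).
  elim: l => [|l IH]; first by rewrite addn0.
  apply: agree_trans IH _; rewrite addnS.
  by have [_ _ + _] := step (k + l); apply: agree_leq.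
(* The symbol at i no longer changes after step i.+1, because i < n i.+1. *)
pose z i := u i.+1 i.
have zE k : agree (n k) (u k) z.
  move=> i ik; rewrite /z (u_agree k i.+1) // addnC.
  by rewrite -(u_agree i.+1 k) // n_ge.
exists z; split.
- apply: admissible_limit => k; exists (u k) => //.
  by apply: agree_leq (zE k).
- exact: (zE 0).
- move=> k; have [_ _ _ [i ik ui]] := step k; exists i.
  by apply: eq_marker ui => l lk; apply: zE; lia.
Qed.

(** Each non-zero position is seen by at most [L] of the windows. *)
Lemma num_nonzero_sum x n L :
  \sum_(t < n) num_nonzero x t L <= L * num_nonzero x 0 (n + L).
Proof.
rewrite /num_nonzero exchange_big /= -[X in X * _]card_ord -sum_nat_const.
apply: leq_sum => j _; rewrite -/(num_nonzero x 0 (n + L)).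
have -> : n + L = j + (n + (L - j)) by have := ltn_ord j; lia.
rewrite num_nonzeroD add0n; apply: leq_trans (leq_addl _ _).
apply: leq_trans (num_nonzero_leqD x j n (L - j)).
by apply: leq_sum => t _; rewrite addnC.
Qed.

Lemma num_nonzero_after_marker x k i n : admissible x -> marker k x i ->
  k * num_nonzero x 0 n <= k * (i + k).+1 + n.
Proof.
move=> xP xi; have := num_nonzero_leqD x 0 n (i + k).+1.
rewrite addnC num_nonzeroD add0n.
have := num_nonzero_leq x 0 (i + k).+1; have := xP.2 _ _ xi n; nia.
Qed.

(** The strength k = 2L(L+1) makes the density 1/(k+1), multiplied by the window
    length [L] and by the number 2 of sequences, at most 1/(L+1). *)
Lemma marked_pair_sparse L x y i : let k := 2 * L * L.+1 in
  admissible x -> marker k x i -> admissible y -> marker k y i ->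
  exists n0, forall n, n0 <= n ->
    L.+1 * (\sum_(t < n) (num_nonzero x t L + num_nonzero y t L)) <= 2 * n.
Proof.
move=> k xP xi yP yi; exists (k * (i + k).+1 + L) => n n0.
have := num_nonzero_after_marker (n + L) xP xi.
have := num_nonzero_after_marker (n + L) yP yi.
rewrite big_split /=; have := num_nonzero_sum x n L.
have := num_nonzero_sum y n L.
set A := \sum_(_ < _) _; set A' := \sum_(_ < _) _.
set c := num_nonzero _ _ _; set c' := num_nonzero _ _ _ => hA' hA hc' hc.
have : 2 * (L.+1 * (A + A')) <= k * c + k * c' by rewrite /k; nia.
lia.
Qed.

(** * The metric on sequences *)

Local Open Scope classical_set_scope.
Local Open Scope ring_scope.

Section SequenceMetric.
Variable R : realType.
Implicit Types x y z : nat -> nat.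

(** An ultrametric that induces the product topology: the balls are the
    cylinders of sequences with a common prefix. *)
Definition seq_dist x y : R :=
  if pselect (exists n, x n != y n) is left xy then (ex_minn xy).+1%:R^-1
  else 0.

Lemma seq_dist_ge0 x y : 0 <= seq_dist x y.
Proof. by rewrite /seq_dist; case: pselect. Qed.

Lemma seq_dist_ge x y n : x n != y n -> n.+1%:R^-1 <= seq_dist x y.
Proof.
move=> xyn; rewrite /seq_dist; case: pselect => [xy|[]]; last by exists n.
by case: ex_minnP => m _ /(_ n xyn) mn; rewrite lef_pV2 ?posrE // ler_nat.
Qed.

Lemma seq_dist_leP x y n : seq_dist x y <= n.+1%:R^-1 <-> agree n x y.
Proof.
split=> [xy i ni|xy].
  apply/eqP; apply: contraLR xy => /seq_dist_ge; rewrite -ltNge.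
  by apply: lt_le_trans; rewrite ltf_pV2 ?posrE // ltr_nat.
rewrite /seq_dist; case: pselect => // nxy; case: ex_minnP => m xym _.
rewrite lef_pV2 ?posrE // ler_nat ltnS leqNgt; apply: contra xym => mn.
by rewrite xy.
Qed.

Lemma seq_dist_le1 x y : seq_dist x y <= 1.
Proof. by rewrite -invr1; apply/(seq_dist_leP x y 0). Qed.

Lemma seq_distxx x : seq_dist x x = 0.
Proof.
by rewrite /seq_dist; case: pselect => // nxx; have [n] := nxx; rewrite eqxx.
Qed.

Lemma seq_dist_eq0 x y : seq_dist x y = 0 -> x = y.
Proof.
move=> xy0; apply/funext => n.
by apply: (proj1 (seq_dist_leP x y n.+1)) => //; rewrite xy0.
Qed.

Lemma seq_dist_ultrametric x y z e : seq_dist x y <= e -> seq_dist y z <= e ->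
  seq_dist x z <= e.
Proof.
move=> xy yz; rewrite {1}/seq_dist; case: pselect => [nxz|_]; last first.
  exact: le_trans (seq_dist_ge0 x y) xy.
case: ex_minnP => m xzm _.
have [xym|xym] := eqVneq (x m) (y m); last exact: le_trans (seq_dist_ge xym) xy.
by apply: le_trans (seq_dist_ge _) yz; rewrite -xym.
Qed.

Lemma seq_dist_sym x y : seq_dist x y = seq_dist y x.
Proof.
have le a b : seq_dist a b <= seq_dist b a.
  rewrite {1}/seq_dist; case: pselect => [nab|_]; last exact: seq_dist_ge0.
  by case: ex_minnP => m abm _; apply: seq_dist_ge; rewrite eq_sym.
by apply/le_anti; rewrite !le.
Qed.

Lemma seq_dist_triangle y x z : seq_dist x z <= seq_dist x y + seq_dist y z.
Proof.
by apply: (@seq_dist_ultrametric x y); rewrite ?lerDl ?lerDr seq_dist_ge0.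
Qed.

(** Two windows of length [L] in which both sequences vanish agree, and in any
    other case the right-hand side is at least 1, which bounds the distance.
    This turns distances along orbits into counts of non-zero symbols. *)
Lemma seq_dist_num_nonzero x y t L :
  seq_dist (fun n => x (t + n)%N) (fun n => y (t + n)%N) <=
  L.+1%:R^-1 + (num_nonzero x t L + num_nonzero y t L)%:R.
Proof.
have [/seq_dist_leP xy|nxy] :=
  pselect (agree L (fun n => x (t + n)%N) (fun n => y (t + n)%N)).
  by rewrite (le_trans xy) // lerDl.
apply: le_trans (seq_dist_le1 _ _) _; rewrite -[leLHS]add0r lerD // ler1n.
rewrite lt0n; apply: contra_notN nxy.
rewrite addn_eq0 /num_nonzero !sum_nat_eq0.
move=> /andP[/forallP x0 /forallP y0] i iL.
have := x0 (Ordinal iL); have := y0 (Ordinal iL).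
by rewrite /= !eqb0 !negbK => /eqP-> /eqP->.
Qed.

End SequenceMetric.

(** * Upper limits and entropy at a scale *)

Section UpperLimits.
Variable R : realType.

Lemma limn_esup_le (u : (\bar R)^nat) (a : \bar R) n0 :
  (forall n, (n0 <= n)%N -> u n <= a)%E -> (limn_esup u <= a)%E.
Proof.
move=> ua; rewrite /limn_esup limf_esupE; apply: ge_ereal_inf.
exists (ereal_sup (u @` [set n | (n0 <= n)%N])).
  by exists [set n | (n0 <= n)%N]; first by exists n0.
by apply: ge_ereal_sup => _ [n /= /ua + <-].
Qed.

Lemma limn_esup_ge (u : (\bar R)^nat) (a : \bar R) n0 :
  (forall n, (n0 <= n)%N -> a <= u n)%E -> (a <= limn_esup u)%E.
Proof.
move=> au; rewrite /limn_esup limf_esupE.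
apply: le_ereal_inf_tmp => _ [A [m _ mA] <-].
apply: le_trans (au _ (leq_maxl n0 m)) _; apply: ereal_sup_ubound.
by exists (maxn n0 m) => //; apply: mA; apply: leq_maxr.
Qed.

Lemma limn_esup_mono (u v : (\bar R)^nat) :
  (forall n, u n <= v n)%E -> (limn_esup u <= limn_esup v)%E.
Proof.
move=> uv; rewrite /limn_esup !limf_esupE.
apply: le_ereal_inf_tmp => _ [A FA <-].
apply: ge_ereal_inf; exists (ereal_sup (u @` A)); first by exists A.
apply: ge_ereal_sup => _ [n An <-].
by apply: le_trans (uv n) _; apply: ereal_sup_ubound; exists n.
Qed.

Lemma entropy_at_scale_nonincreasing (Y : metricType R) (T : Y -> Y)
    (e e' : R) : e <= e' -> (entropy_at_scale T e' <= entropy_at_scale T e)%E.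
Proof.
move=> ee'; apply: limn_esup_mono => n.
have sep0 r : (0 <= max_separated T n r)%E.
  by apply: ereal_sup_ubound; exists fset0.
rewrite lee_wpmul2l // lee_lne ?in_itv /= ?leey ?sep0 //.
apply: ereal_sup_le => _ [E sepE <-]; exists E => // x y xE yE xy.
exact: le_lt_trans ee' (sepE x y xE yE xy).
Qed.

End UpperLimits.

(** * The marker subshift as a metric system *)

Record marker_shift (R : realType) :=
  MarkerShift { symbols :> nat -> nat; _ : admissible symbols }.

Section MarkerShiftTheory.
Variable R : realType.
Notation X := (marker_shift R).
Implicit Types x y : X.

Lemma marker_shiftP x : admissible x. Proof. by case: x. Qed.

Lemma marker_shift_inj x y : symbols x = symbols y -> x = y.
Proof.
move: x y => [x xP] [y yP] /= xy; move: xP; rewrite xy => xP.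
by congr MarkerShift; apply: Prop_irrelevance.
Qed.

HB.instance Definition _ := gen_eqMixin X.
HB.instance Definition _ := gen_choiceMixin X.

Let dist x y : R := seq_dist R x y.

Let dist_eq0 x y : dist x y = 0 -> x = y.
Proof. by move=> /seq_dist_eq0/marker_shift_inj. Qed.

Let dist_triangle y x z : dist x z <= dist x y + dist y z.
Proof. exact: seq_dist_triangle. Qed.

HB.instance Definition _ := @isMetric.Build R X dist
  (fun x => seq_distxx R x) dist_eq0 (fun x y => seq_dist_sym R x y)
  dist_triangle.

Lemma mdist_symbolsE x y : mdist x y = seq_dist R x y. Proof. by []. Qed.

Lemma admissible_shift (u : nat -> nat) t :
  admissible u -> admissible (fun n => u (t + n)%N).
Proof.
case=> u3 uP; split=> [n|k i ui m]; first exact: u3.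
rewrite (@eq_num_nonzero _ u _ (t + i + k).+1) => [|j _]; last by congr u; lia.
by apply: uP; apply: eq_marker ui => l _; rewrite addnA.
Qed.

Definition shift x : X := MarkerShift R (admissible_shift 1 (marker_shiftP x)).

Lemma iter_shiftE t x n : iter t shift x n = x (t + n)%N.
Proof. by elim: t n => // t IH n; rewrite iterS /= IH; congr (x _); lia. Qed.

Lemma iter_shift t x : symbols (iter t shift x) = (fun n => x (t + n)%N).
Proof. by apply/funext => n; rewrite iter_shiftE. Qed.

Lemma nbhs_agreeP x (A : set X) :
  nbhs x A <-> exists n, forall y, agree n x y -> A y.
Proof.
rewrite nbhs_ballP; split=> [[e /= e0 eA]|[n nA]].
  have [n ne] : exists n, n.+1%:R^-1 < e.
    exists (Num.bound e^-1); rewrite invf_plt ?posrE //.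
    apply: lt_le_trans (archi_boundP _) _; rewrite ?ler_nat // invr_ge0 ltW //.
  exists n => y /seq_dist_leP xy; apply: eA; rewrite ballEmdist /=.
  exact: le_lt_trans (xy R) ne.
exists n.+1%:R^-1 => //= y; rewrite ballEmdist /= => /ltW xy.
by apply: nA; apply/(seq_dist_leP R).
Qed.

Lemma open_agreeP (U : set X) : open U -> forall x, U x ->
  exists n, forall y, agree n x y -> U y.
Proof. by move=> oU x Ux; apply/nbhs_agreeP/open_nbhs_nbhs. Qed.

Lemma continuous_shift : continuous shift.
Proof.
move=> x A /nbhs_agreeP[n nA]; apply/nbhs_agreeP; exists n.+1 => y xy.
by apply: nA => i ni; apply: xy.
Qed.

Lemma agree_nbhs_prod (z : prod_topology (fun _ : nat => nat)) n :
  nbhs z [set y | agree n z y].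
Proof.
elim: n => [|n IH]; first by apply: filterS filterT.
have zn : nbhs z [set y | y n = z n].
  apply: (@proj_continuous _ (fun=> nat) n z [set k | k = z n]).
  by apply: open_nbhs_nbhs; split=> //; apply: discrete_open.
apply: filterS (filterI IH zn) => y [zy yn] i.
by rewrite ltnS leq_eqVlt => /orP[/eqP->|/zy].
Qed.

(** The subshift is the continuous image of a closed subset of the product of
    the finite sets {0, 1, 2}, which is compact by Tychonoff. *)
Lemma compact_marker_shift : compact [set: X].
Proof.
pose A : set (prod_topology (fun _ : nat => nat)) := [set u | admissible u].
have o_adm : admissible (fun=> 0%N) by apply: admissible_binary.
pose f (u : prod_topology (fun _ : nat => nat)) : X :=
  if pselect (admissible u) is left uP then MarkerShift R uP
  else MarkerShift R o_adm.
have fE u : A u -> symbols (f u) = u by rewrite /f; case: pselect.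
have -> : [set: X] = f @` A.
  apply/seteqP; split=> // x _; exists (x : nat -> nat).
    exact: marker_shiftP.
  by apply: marker_shift_inj; rewrite fE //; apply: marker_shiftP.
apply: continuous_compact.
  apply/subspace_continuousP => u uP W /nbhs_agreeP[n nW].
  apply: filterS (agree_nbhs_prod u n) => v uv vP; apply: nW.
  by rewrite !fE.
apply: (@subclosed_compact _ A [set u | forall n, [set k | k < 3]%N (u n)]).
- move=> u /(_ _ (agree_nbhs_prod u _)) uA; apply: admissible_limit => n.
  by have [v [vP uv]] := uA n; exists v => //; apply: agree_sym.
- apply: (@tychonoff nat (fun=> nat) (fun=> [set k | k < 3]%N)) => _.
  exact/finite_compact/finite_II.
- by move=> u [].
Qed.

Lemma tds_shift : tds shift.
Proof.
split; [|exact: compact_marker_shift|exact: continuous_shift].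
by exists (MarkerShift R (@admissible_binary (fun=> 0%N) (fun=> isT))).
Qed.

(** Transitivity and density of periodic points in one statement: for the latter,
    take [y] to be [x]. *)
Lemma periodic_joining x y N : exists p : X,
  [/\ periodic_point shift p, agree N x p &
      exists2 n, (0 < n)%N & agree N y (iter n shift p)].
Proof.
(* N.+1 rather than N, so that the period is positive. *)
pose M := N.+1; pose B := spaced_block_size M.
have B0 : (0 < B)%N by rewrite /B /spaced_block_size; lia.
have pP : admissible (periodic_spaced M x y).
  by apply: admissible_spaced => q; case: odd; apply: marker_shiftP.
exists (MarkerShift R pP); split.
- exists (2 * B)%N; first by rewrite muln_gt0.
  apply: marker_shift_inj; rewrite iter_shift; apply/funext => n /=.
  by rewrite addnC periodic_spacedD.
- by apply: (agree_leq (leqnSn N)); apply: periodic_spaced_fst.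
- exists B => //; rewrite iter_shift.
  by apply: (agree_leq (leqnSn N)); apply: periodic_spaced_snd.
Qed.

Lemma devaney_chaotic_shift : devaney_chaotic shift.
Proof.
split=> [U V oU [x Ux] oV [y Vy]|U [x Ux] oU].
  have [n nU] := open_agreeP oU Ux; have [m mV] := open_agreeP oV Vy.
  have [p [_ xp [t t0 yp]]] := periodic_joining x y (maxn n m).
  exists t => //; exists (iter t shift p); split.
    by exists p => //; apply/nU/(agree_leq _ xp)/leq_maxl.
  by apply/mV/(agree_leq _ yp)/leq_maxr.
have [n nU] := open_agreeP oU Ux.
have [p [pp xp _]] := periodic_joining x x n.
by exists p; split => //; apply: nU.
Qed.

(** The points need not be close to each other: a common marker already brings
    both orbits near the fixed point 0 most of the time. *)
Lemma limsup_mean_dist_marker L i x y : let k := (2 * L * L.+1)%N in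
  marker k x i -> marker k y i ->
  (limsup_mean_dist shift x y <= (3 / L.+1%:R)%:E)%E.
Proof.
move=> k xi yi.
have [n0 sparse] :=
  marked_pair_sparse (marker_shiftP x) xi (marker_shiftP y) yi.
apply: (@limn_esup_le _ _ _ n0.+1) => n n0n; rewrite lee_fin.
have n_gt0 : 0 < n%:R :> R by rewrite ltr0n; lia.
have L_gt0 : 0 < L.+1%:R :> R by [].
rewrite ler_pdivrMl //.
pose c t := (num_nonzero x t L + num_nonzero y t L)%N.
apply: (@le_trans _ _ (\sum_(t < n) (L.+1%:R^-1 + (c t)%:R))).
  by apply: ler_sum => t _;
     rewrite mdist_symbolsE !iter_shift seq_dist_num_nonzero.
rewrite big_split /= sumr_const card_ord -natr_sum -[X in X + _]mulr_natl.
have : (\sum_(t < n) c t)%:R <= 2 * n%:R / L.+1%:R :> R.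
  by rewrite ler_pdivlMr // -!natrM ler_nat mulnC sparse // ltnW.
rewrite -(lerD2l (n%:R / L.+1%:R)) => /le_trans; apply.
by rewrite [leRHS](_ : _ = n%:R / L.+1%:R + 2 * n%:R / L.+1%:R) //; ring.
Qed.

Lemma limsup_mean_dist_lt (e : R) : 0 < e -> exists k, forall i x y,
  marker k x i -> marker k y i -> (limsup_mean_dist shift x y < e%:E)%E.
Proof.
move=> e0.
exists (2 * Num.bound (3 / e) * (Num.bound (3 / e)).+1)%N => i x y xi yi.
apply: le_lt_trans (limsup_mean_dist_marker xi yi) _.
rewrite lte_fin ltr_pdivrMr // mulrC -ltr_pdivrMr //.
by apply: lt_le_trans (archi_boundP _) _; rewrite ?ler_nat // divr_ge0 // ltW.
Qed.

Lemma marker_agree k i (x y : nat -> nat) :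
  agree (i + k).+1 x y -> marker k x i -> marker k y i.
Proof. by move=> xy; apply: eq_marker => l lk; apply: xy; lia. Qed.

Definition rich : set X := [set x | forall k, exists i, marker k x i].

Lemma dense_rich : dense rich.
Proof.
move=> U [x Ux] oU; have [n nU] := open_agreeP oU Ux.
have [z [zP xz zrich]] := exists_rich n (marker_shiftP x).
by exists (MarkerShift R zP); split => //; apply: nU.
Qed.

Lemma Gdelta_rich : Gdelta rich.
Proof.
exists (fun k => [set x : X | exists i, marker k x i]); last first.
  by apply/seteqP; split=> x xk k; [move=> _; apply: xk|apply: (xk k I)].
move=> k; rewrite openE => x [i xi].
apply/nbhs_agreeP; exists (i + k).+1 => y xy.
by exists i; apply: marker_agree xi.
Qed.

Lemma mean_equicontinuous_rich : rich `<=` mean_equicontinuous_point shift.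
Proof.
move=> x xrich e /limsup_mean_dist_lt[k ke]; have [i xi] := xrich k.
(* Distance at most 1/(m+1) means agreement below m; here m = i+k+1, just past
   the marker. *)
exists (i + k).+2%:R^-1 => // y /ltW/(seq_dist_leP R) xy.
by apply: (ke i) => //; apply: marker_agree xi.
Qed.

Lemma almost_mean_equicontinuous_shift : almost_mean_equicontinuous shift.
Proof.
by exists rich; split; [exact: Gdelta_rich|exact: dense_rich|
                        exact: mean_equicontinuous_rich].
Qed.

Lemma not_mean_sensitive_shift : ~ mean_sensitive shift.
Proof.
move=> [d /limsup_mean_dist_lt[k kd]].
move=> /(_ [set x : X | marker k x 0%N])[||x [y]].
- rewrite openE => x x0; apply/nbhs_agreeP; exists (0 + k).+1 => y xy.
  exact: marker_agree x0.
- exists (MarkerShift R (admissible_marker_word k)).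
  by apply: marker_marker_word.
- by case=> x0 y0; rewrite ltNge (ltW (kd _ _ _ x0 y0)).
Qed.

Definition binary_code n (t : n.-tuple bool) : nat -> nat :=
  fun i => nat_of_bool (nth false t i).

Lemma binary_code_admissible n (t : n.-tuple bool) : admissible (binary_code t).
Proof. by apply: admissible_binary => i; rewrite /binary_code; case: nth. Qed.

Definition binary_point n (t : n.-tuple bool) : X :=
  MarkerShift R (binary_code_admissible t).

Lemma binary_point_neq n (s t : n.-tuple bool) : s != t ->
  exists2 i, (i < n)%N & binary_point s i != binary_point t i.
Proof.
move=> st; apply: contrapT => nst; move/eqP: st; apply.
apply/val_inj/(@eq_from_nth _ false); rewrite ?size_tuple // => i ni.
apply/eqP; apply: contra_notT nst => sti; exists i => //.
by move: sti; rewrite /= /binary_code; do 2 case: nth.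
Qed.

(** The 2^n binary words of length n, continued by zeros, are separated: two of
    them differ at some time i < n in the first symbol, which is distance 1. *)
Lemma max_separated_shift n e : e < 1 ->
  ((2 ^ n)%:R%:E <= max_separated shift n e)%E.
Proof.
move=> e1; pose E := [fset binary_point t | t in {: n.-tuple bool}]%fset.
apply: ereal_sup_ubound; exists E.
  move=> _ _ /imfsetP[s _ ->] /imfsetP[t _ ->] st.
  have [|i ni sti] := @binary_point_neq _ s t.
    by apply: contraNN st => /eqP->.
  rewrite /bowen_dist; apply: (lt_le_trans e1).
  apply: le_trans (le_bigmax _ _ (Ordinal ni)) => /=.
  rewrite mdist_symbolsE !iter_shift.
  by rewrite -[leLHS]invr1; apply: (@seq_dist_ge _ _ _ 0%N); rewrite !addn0.
rewrite card_imfset /=; last first.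
  move=> s t st; apply/eqP; apply: contraPT st => /binary_point_neq[i _ sti] st.
  by rewrite st eqxx in sti.
by rewrite -cardE card_tuple card_bool.
Qed.

Lemma entropy_at_scale_shift e : e < 1 ->
  ((ln 2)%:E <= entropy_at_scale shift e)%E.
Proof.
move=> e1; apply: (@limn_esup_ge _ _ _ 1) => n n1.
have n0 : 0 < n%:R :> R by rewrite ltr0n.
have -> : (ln 2)%:E = ((n%:R^-1)%:E * lne (2 ^ n)%:R%:E)%E :> \bar R.
  rewrite lne_EFin ?ltr0n ?expn_gt0 // natrX lnXn // -EFinM.
  rewrite -[ln _ *+ n]mulr_natl.
  by rewrite mulKf // gt_eqF.
rewrite lee_pmul2l ?lte_fin ?invr_gt0 // lee_lne ?max_separated_shift //.
- by rewrite in_itv /= leey andbT lee_fin ler0n.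
- rewrite in_itv /= leey andbT; apply: le_trans (max_separated_shift n e1).
  by rewrite lee_fin ler0n.
Qed.

(** Monotonicity in the scale is what makes the limit that defines the entropy
    exist, so that the bound at small scales passes to it. *)
Lemma topological_entropy_shift_gt0 : (0 < topological_entropy shift)%E.
Proof.
apply: (@lt_le_trans _ _ (ln 2)%:E); first by rewrite lte_fin ln_gt0 // ltr1n.
apply: lime_ge.
  apply/cvg_ex; eexists; apply: (nonincreasing_at_right_cvge (BRight 1)).
    by rewrite ltBSide /= ltr01.
  by move=> e e' _ _; apply: entropy_at_scale_nonincreasing.
near=> e; apply: entropy_at_scale_shift; near: e; exact: nbhs_right_lt.
Unshelve. all: by end_near. Qed.

End MarkerShiftTheory.

Theorem theorem1p4 (R : realType) :
  exists (X : metricType R) (T : X -> X),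
    [/\ tds T,
        devaney_chaotic T,
        (0 < topological_entropy T)%E,
        almost_mean_equicontinuous T &
        ~ mean_sensitive T].
Proof.
exists (marker_shift R), (@shift R); split.
- exact: tds_shift.
- exact: devaney_chaotic_shift.
- exact: topological_entropy_shift_gt0.
- exact: almost_mean_equicontinuous_shift.
- exact: not_mean_sensitive_shift.
Qed.
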